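(* Let $l\ge3$ and let $L$, $N$, $V_L$, $\psi_1$, $\psi_2$, $\rho$ be as defined in the context. Then: (1) $N=\{\beta\in L\mid\langle\alpha_1+\cdots+\alpha_l,\beta\rangle\equiv0\pmod 4\}$. (2) $V_N=\{v\in V_L\mid\psi_1(v)=v\}$. (3) $\rho(V_N)=V_L^{+}$, where $V_L^{+}=\{v\in V_L\mid\psi_2(v)=v\}$.
   Context: $L=\bigoplus_{i=1}^{l}\mathbb Z\alpha_i$ with $\langle\alpha_i,\alpha_j\rangle=2\delta_{ij}$, and $N=\sum_{i,j=1}^{l}\mathbb Z(\alpha_i\pm\alpha_j)\subset L$ (isomorphic to $\sqrt2D_l$). $V_L=M(1)\otimes\mathbb C[L]$ is the lattice vertex operator algebra (trivial cocycle, since all inner products in $L$ are even), $V_L=V_{\mathbb Z\alpha_1}\otimes\cdots\otimes V_{\mathbb Z\alpha_l}$, and $V_N=M(1)\otimes\mathbb C[N]\subset V_L$. Let $\mathbb Z\alpha$ be a rank one lattice with $\langle\alpha,\alpha\rangle=2$. The vertex operator algebra $V_{\mathbb Z\alpha}$ has automorphisms $\theta_1,\theta_2,\sigma$ of order two determined by: $\theta_1:\alpha(-1)\mapsto\alpha(-1),\ e^{\pm\alpha}\mapsto-e^{\pm\alpha}$; $\theta_2:\alpha(-1)\mapsto-\alpha(-1),\ e^{\pm\alpha}\mapsto e^{\mp\alpha}$; $\sigma:\alpha(-1)\mapsto e^{\alpha}+e^{-\alpha},\ e^{\alpha}+e^{-\alpha}\mapsto\alpha(-1),\ e^{\alpha}-e^{-\alpha}\mapsto-(e^{\alpha}-e^{-\alpha})$.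 On $V_L$ put $\psi_1=\theta_1\otimes\cdots\otimes\theta_1$, $\psi_2=\theta_2\otimes\cdots\otimes\theta_2$ (the automorphism induced by $\beta\mapsto-\beta$), $\tau=\sigma\otimes\cdots\otimes\sigma$. Thus $\psi_1(u\otimes e^\beta)=(-1)^{\langle\alpha_1+\cdots+\alpha_l,\beta\rangle/2}u\otimes e^\beta$ for $u\in M(1)$, $\beta\in L$. Let $\varphi$ be the automorphism of $V_L$ with $\varphi(u\otimes e^\beta)=(-1)^{\langle\alpha_2+\alpha_3,\beta\rangle/2}u\otimes e^\beta$ for $u\in M(1)$, $\beta\in L$, and set $\rho=\varphi\tau$ (apply $\tau$ first). *)

(* Defs.v *)
From HB Require Import structures.
From mathcomp Require Import all_boot all_order all_algebra.
From mathcomp Require Import finmap complex.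
From mathcomp Require Import mathcomp_extra boolp classical_sets functions.
From mathcomp Require Import cardinality fsbigop reals.
From mathcomp Require Import monalg.

Set Implicit Arguments.
Unset Strict Implicit.
Unset Printing Implicit Defensive.
Import Order.TTheory GRing.Theory Num.Theory.
Local Open Scope classical_set_scope.
Local Open Scope ring_scope.

(** The lattice [L = Z alpha_1 + ... + Z alpha_l], in the coordinates given by
    the [alpha_i]; in 1-based indexing, [alpha_i] is [alpha] at the ordinal of
    value [i - 1]. The rank one lattice [Z alpha] is [Lat 1]. *)
Definition Lat (l : nat) := {ffun 'I_l -> int}.

Definition alpha (l : nat) (i : 'I_l) : Lat l := [ffun j => (i == j)%:Z].

Definition inner (l : nat) (b c : Lat l) : int := \sum_(i < l) 2 * b i * c i.

Definition latN (l : nat) : set (Lat l) :=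
  [set b | exists x y : 'I_l -> 'I_l -> int,
     b = \sum_(i < l) \sum_(j < l)
           ((alpha i + alpha j) *~ x i j + (alpha i - alpha j) *~ y i j)].
Arguments latN l : clear implicits.

(** [V_L = M(1) (x) C[L]]. The variable [(i, k)] stands for [alpha_i(-(k+1))],
    so [M(1)] is the polynomial algebra with monomial basis [heis_mon l], and
    [BasisVec m b] stands for the basis vector [m (x) e^b] of [V_L]. *)
Definition heis_mon (l : nat) := {cmonom ('I_l * nat)%type}.

Record VL_basis (l : nat) := BasisVec {
  hpart : heis_mon l;
  lpart : Lat l }.
Arguments BasisVec {l}.
Arguments hpart {l}.
Arguments lpart {l}.

HB.instance Definition _ (l : nat) := gen_eqMixin (VL_basis l).
HB.instance Definition _ (l : nat) := gen_choiceMixin (VL_basis l).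

Definition VLat (C : numFieldType) (l : nat) : lmodType C := {malg C[VL_basis l]}.

Section LatticeVOA.
Context {C : numFieldType}.

Definition lin_ext (K : choiceType) (W : lmodType C) (f : K -> W)
  (v : {malg C[K]}) : W := \sum_(b <- msupp v) v@_b *: f b.

(** Formal power series with coefficients in the linear operators on [W]. *)
Section OperatorSeries.
Context {W : lmodType C}.

Definition ser_one (k : nat) (v : W) : W := if k == 0%N then v else 0.

Definition ser_mul (F G : nat -> W -> W) (k : nat) (v : W) : W :=
  \sum_(i < k.+1) F i (G (k - i)%N v).

Definition ser_pow (F : nat -> W -> W) (r : nat) : nat -> W -> W :=
  iter r (ser_mul F) ser_one.

(** For [F] without constant term, the powers [F^r] with [r > k] do not
    contribute to the coefficient of index [k] of [exp F]. *)
Definition ser_exp (F : nat -> W -> W) (k : nat) (v : W) : W :=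
  \sum_(r < k.+1) (r`!%:R)^-1 *: ser_pow F r k v.

End OperatorSeries.

(** A field [A(z) = sum_n A_n z^(-n-1)] is given by its modes [A_n]. The sums
    below are over infinite index sets; on the fields occurring here only
    finitely many terms are nonzero on a given vector. *)
Section Fields.
Context {W : lmodType C}.

Definition field_deriv (A : int -> W -> W) (n : int) (v : W) : W :=
  (- n)%:~R *: A (n - 1) v.

(** [(1/k!) (d/dz)^k A(z)] *)
Definition field_dderiv (k : nat) (A : int -> W -> W) (n : int) (v : W) : W :=
  (k`!%:R)^-1 *: iter k field_deriv A n v.

(** [:A(z)B(z): = (sum_(j < 0) A_j z^(-j-1)) B(z)
                  + B(z) (sum_(j >= 0) A_j z^(-j-1))] *)
Definition nop (A B : int -> W -> W) (n : int) (v : W) : W :=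
  \sum_(j \in [set: nat]) A (- (j%:Z + 1)) (B (n + j%:Z) v)
  + \sum_(j \in [set: nat]) B (n - 1 - j%:Z) (A j%:Z v).

End Fields.

Section Rank.
Context {l : nat}.
Local Notation VL := (VLat C l).

Definition bvec (m : heis_mon l) (b : Lat l) : VL := << BasisVec m b >>.

(** [alpha_i(n)]: multiplication by [alpha_i(n)] if [n < 0], the scalar
    [<alpha_i, b>] on [M(1) (x) e^b] if [n = 0], and
    [2 n d/d(alpha_i(-n))] if [n > 0]. *)
Definition alpha_mode (i : 'I_l) (n : int) : VL -> VL :=
  lin_ext (fun b : VL_basis l =>
    match n with
    | Negz k => bvec (mmul (ucm (i, k)) (hpart b)) (lpart b)
    | Posz 0 => (inner (alpha i) (lpart b))%:~R *: << b >>
    | Posz k.+1 =>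
        (2 * k.+1 * hpart b (i, k))%N%:R
          *: bvec (divcm (hpart b) (ucm (i, k))) (lpart b)
    end).

Definition lat_mode (b : Lat l) (n : int) (v : VL) : VL :=
  \sum_(i < l) (b i)%:~R *: alpha_mode i n v.

(** Coefficient of [z^k] in [exp (sum_(n > 0) b(-n) z^n / n)]. *)
Definition Eminus (b : Lat l) : nat -> VL -> VL :=
  ser_exp (fun n v => if n == 0%N then 0 else n%:R^-1 *: lat_mode b (- n%:Z) v).

(** Coefficient of [z^(-k)] in [exp (- sum_(n > 0) b(n) z^(-n) / n)]. *)
Definition Eplus (b : Lat l) : nat -> VL -> VL :=
  ser_exp (fun n v => if n == 0%N then 0 else - (n%:R^-1 *: lat_mode b n%:Z v)).

(** [Y(e^b, z) = exp (sum_(n > 0) b(-n) z^n / n)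
                 exp (- sum_(n > 0) b(n) z^(-n) / n) e^b z^(b(0))],
    with [e^b (m (x) e^c) = m (x) e^(b + c)]. *)
Definition Yexp (b : Lat l) (n : int) : VL -> VL :=
  lin_ext (fun c : VL_basis l =>
    \sum_(p \in [set p : nat * nat |
                   p.1%:Z - p.2%:Z + inner b (lpart c) = - n - 1])
      Eminus b p.1 (Eplus b p.2 (bvec (hpart c) (b + lpart c)))).

(** The variables occurring in a monomial, repeated with multiplicity. *)
Definition mon_factors (m : heis_mon l) : seq ('I_l * nat) :=
  flatten [seq nseq (m x) x | x <- finsupp m].

(** [Y(alpha_i1(-k1-1) ... alpha_ir(-kr-1) (x) e^b, z)
     = : (1/k1!) d^k1 alpha_i1(z) ... (1/kr!) d^kr alpha_ir(z) Y(e^b, z) :] *)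
Definition Ybasis (a : VL_basis l) : int -> VL -> VL :=
  foldr (fun x B => nop (field_dderiv x.2 (alpha_mode x.1)) B)
        (Yexp (lpart a)) (mon_factors (hpart a)).

(** The product [u_n v], where [Y(u, z) = sum_n u_n z^(-n-1)]. *)
Definition Yprod (u : VL) (n : int) (v : VL) : VL :=
  lin_ext (fun a => Ybasis a n v) u.

Definition vac : VL := bvec mone 0.

(** As [alpha_i / sqrt 2] is an orthonormal basis, the conformal vector is
    [(1/4) sum_i alpha_i(-1)^2 1]. *)
Definition conformal : VL :=
  4%:R^-1 *: \sum_(i < l) bvec (mmul (ucm (i, 0%N)) (ucm (i, 0%N))) 0.

Record voa_automorphism (g : VL -> VL) : Prop := VoaAutomorphism {
  voa_aut_linear : linear g;
  voa_aut_bij : bijective g;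
  voa_aut_prod : forall u n v, g (Yprod u n v) = Yprod (g u) n (g v);
  voa_aut_vac : g vac = vac;
  voa_aut_conformal : g conformal = conformal }.

End Rank.

Definition alpha_vec : VLat C 1 := bvec (ucm (ord0, 0%N)) 0.
Definition exp_alpha : VLat C 1 := bvec mone (alpha ord0).
Definition exp_Nalpha : VLat C 1 := bvec mone (- alpha ord0).

Definition is_theta1 (g : VLat C 1 -> VLat C 1) : Prop :=
  [/\ voa_automorphism g, g alpha_vec = alpha_vec,
      g exp_alpha = - exp_alpha & g exp_Nalpha = - exp_Nalpha].

Definition is_theta2 (g : VLat C 1 -> VLat C 1) : Prop :=
  [/\ voa_automorphism g, g alpha_vec = - alpha_vec,
      g exp_alpha = exp_Nalpha & g exp_Nalpha = exp_alpha].

Definition is_sigma (g : VLat C 1 -> VLat C 1) : Prop :=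
  [/\ voa_automorphism g, g alpha_vec = exp_alpha + exp_Nalpha,
      g (exp_alpha + exp_Nalpha) = alpha_vec
    & g (exp_alpha - exp_Nalpha) = - (exp_alpha - exp_Nalpha)].

Section Tensor.
Context {l : nat}.

(** Identification of [V_L] with the tensor product of the [V_(Z alpha_i)]:
    a basis vector [b] of [V_L] is the tensor product of the basis vectors
    [slot i b], and the [slot i] identify [VL_basis l] with the [l]-th power of
    [VL_basis 1]. *)
Definition slot (i : 'I_l) (b : VL_basis l) : VL_basis 1 :=
  BasisVec
    [cmonom hpart b (i, x.2)
      | x in [fset ((ord0 : 'I_1), y.2) | y in finsupp (hpart b)]%fset]%M
    [ffun => lpart b i].

(** [v_1 (x) ... (x) v_l] *)
Definition tensor (v : 'I_l -> VLat C 1) : VLat C l :=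
  \sum_(b \in [set: VL_basis l]) (\prod_(i < l) (v i)@_(slot i b)) *: << b >>.

(** [f (x) ... (x) f] *)
Definition tensor_power (f : VLat C 1 -> VLat C 1) : VLat C l -> VLat C l :=
  lin_ext (fun b : VL_basis l => tensor (fun i => f << slot i b >>)).

(** The operator [u (x) e^b |-> (-1)^(<c, b> / 2) u (x) e^b]; the division is
    exact, as [inner] takes even values. *)
Definition sign_op (c : Lat l) : VLat C l -> VLat C l :=
  lin_ext (fun b : VL_basis l =>
    (-1 : C) ^ (inner c (lpart b) %/ 2)%Z *: << b >>).

(** [M(1) (x) C[N]] *)
Definition VN : set (VLat C l) :=
  [set v | forall b : VL_basis l, b \in msupp v -> latN l (lpart b)].

(** The ordinals below are those of value 1 and 2: this is the sign operator
    of [alpha_2 + alpha_3] in the 1-based indexing. *)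
Definition phi (hl : (3 <= l)%N) : VLat C l -> VLat C l :=
  sign_op (alpha (Ordinal (ltnW hl : (1 < l)%N)) + alpha (Ordinal hl)).

End Tensor.
End LatticeVOA.

Arguments VN C l : clear implicits.

(* Main.v *)
Require Import Defs.
From mathcomp Require Import all_boot all_order all_algebra.
From mathcomp Require Import finmap complex boolp classical_sets fsbigop reals.
From mathcomp Require Import monalg.
From mathcomp Require Import ring zify.

Set Implicit Arguments.
Unset Strict Implicit.
Unset Printing Implicit Defensive.
Import Order.TTheory GRing.Theory Num.Theory.
Local Open Scope classical_set_scope.
Local Open Scope ring_scope.

(** Part (1) is a parity statement: [<alpha_1 + ... + alpha_l, b>] is twice the
    sum of the coordinates of [b], and [N] is the sublattice of even coordinate
    sum ([latN_even]).

    The other two parts rest on generation. The vertex algebra of [Z alpha] is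
    generated by [alpha(-1)], [e^alpha] and [e^(-alpha)]: starting from the
    vacuum, every basis vector is reached by the operators [alpha(-k-1)], which
    are modes of [alpha(-1)], and by one mode of [e^(+-alpha)], which sends
    [e^c] to [e^(c +- alpha)]. An induction along this generation
    ([VZalpha_basis_ind]) gives everything that is needed in rank one:
    - [theta_1] acts on [m (x) e^c] by [(-1)^c] ([theta1_basis]), and [theta_2]
      sends it to [+-m (x) e^(-c)] ([theta2_basis]);
    - two automorphisms that agree on the three generators are equal
      ([voa_automorphism_eq]); comparing values on the generators,
      [sigma^2 = 1] and [sigma theta_1 = theta_2 sigma].

    Taking tensor powers is functorial ([tensor_power_comp]), so these facts
    pass to rank [l]. There [psi_1] acts on [m (x) e^b] by the sign
    [(-1)^(b_1 + ... + b_l)]; its fixed vectors are those supported on lattice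
    elements of even coordinate sum, which together with (1) is (2). Moreover
    [tau] is an involution with [tau psi_1 = psi_2 tau], and [phi] is an
    involution that commutes with [psi_2], because its sign at [b] is the same
    as at [-b]. Hence [rho = phi tau] carries the fixed vectors of [psi_1] onto
    those of [psi_2] ([image_fixed_points]), which is (3). *)

(** * The lattice N *)

Lemma inner_alpha_sum l (b : Lat l) :
  inner (\sum_(i < l) alpha i) b = 2 * \sum_(i < l) b i.
Proof.
rewrite /inner mulr_sumr; apply: eq_bigr => j _.
rewrite sum_ffunE (bigD1 j) //= ffunE eqxx big1 ?addr0 ?mulr1 // => i ij.
by rewrite ffunE (negbTE ij).
Qed.

(** For the converse, the coordinates [b_i] with even sum [s] give
    [b = sum_i b_i (alpha_i - alpha_1) + (s / 2) (alpha_1 + alpha_1)]. *)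
Lemma latN_even l (b : Lat l) : latN l b <-> (2 %| \sum_(i < l) b i)%Z.
Proof.
have tot (x : int) (i : 'I_l) : \sum_(k < l) (alpha i *~ x) k = x.
  rewrite (bigD1 i) //= big1 => [|k ki]; rewrite ffunMzE ffunE.
    by rewrite eqxx addr0 /=; lia.
  by rewrite eq_sym (negbTE ki) mul0rz.
split=> [[x [y ->]]|/dvdzP[q sum_b]].
  under eq_bigr do rewrite sum_ffunE.
  rewrite exchange_big; apply: rpred_sum => i _ /=.
  under eq_bigr do rewrite sum_ffunE.
  rewrite exchange_big; apply: rpred_sum => j _ /=.
  suff -> : \sum_(k < l) ((alpha i + alpha j) *~ x i j
      + (alpha i - alpha j) *~ y i j) k = 2 * x i j.
    by rewrite dvdz_mulr.
  under eq_bigr do rewrite ffunE mulrzDl mulrzBl !ffunE.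
  rewrite big_split /= !big_split /= sumrN.
  rewrite !tot; lia.
case: l b tot sum_b => [|l] b tot sum_b.
  exists (fun _ _ => 0), (fun _ _ => 0); rewrite big_ord0.
  by apply/ffunP => -[].
exists (fun i j => if (i == ord0) && (j == ord0) then q else 0).
exists (fun i j => if j == ord0 then b i else 0).
apply/ffunP => k; rewrite sum_ffunE.
under eq_bigr => i _.
  rewrite sum_ffunE (bigD1 ord0) //= big1 => [|j /negbTE j0]; last first.
    by rewrite j0 andbF !mulr0z addr0 ffunE.
  rewrite addr0 andbT ffunE !ffunMzE !ffunE !mulrzz.
  over.
rewrite big_split /=.
have -> : \sum_i ((i == k)%:Z - (ord0 == k)%:Z) * b i
    = b k - (ord0 == k)%:Z * (q * 2).
  rewrite -sum_b mulr_sumr; under eq_bigr do rewrite mulrBl.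
  rewrite sumrB (bigD1 k) //= eqxx mul1r big1 ?addr0 // => i /negbTE ->.
  by rewrite mul0r.
rewrite (bigD1 ord0) //= big1 => [|i /negbTE ->]; last by rewrite mulr0.
ring.
Qed.

(** * Linear maps given on a basis *)

Section LinExt.
Context {C : numFieldType}.

Lemma linear_sum_scale (V W : lmodType C) (g : V -> W) :
  linear g -> forall (I : Type) (r : seq I) (c : I -> C) (v : I -> V),
    g (\sum_(i <- r) c i *: v i) = \sum_(i <- r) c i *: g (v i).
Proof.
move=> gL I r c v; elim: r => [|i r IH]; last by rewrite !big_cons gL IH.
by rewrite !big_nil -{1}(addr0 0) -{1}(scaler0 _ (-1)) gL scaleN1r addNr.
Qed.

Lemma linear_scale (V W : lmodType C) (g : V -> W) :
  linear g -> forall a v, g (a *: v) = a *: g v.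
Proof.
move=> gL a v; have := linear_sum_scale gL [:: tt] (fun=> a) (fun=> v).
by rewrite !big_seq1.
Qed.

Lemma linear_map0 (V W : lmodType C) (g : V -> W) : linear g -> g 0 = 0.
Proof. by move=> gL; have := linear_scale gL 0 0; rewrite !scale0r. Qed.

Lemma linear_mapN (V W : lmodType C) (g : V -> W) :
  linear g -> forall u, g (- u) = - g u.
Proof. by move=> gL u; rewrite -scaleN1r (linear_scale gL) scaleN1r. Qed.

Lemma linear_mapD (V W : lmodType C) (g : V -> W) :
  linear g -> forall u v, g (u + v) = g u + g v.
Proof. by move=> gL u v; have := gL 1 u v; rewrite !scale1r. Qed.

Lemma malg_expand (K : choiceType) (S : {fset K}) (v : {malg C[K]}) :
  (msupp v `<=` S)%fset -> v = \sum_(x <- S) v@_x *: << x >>.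
Proof.
move=> /monalgEw {1}->; apply: eq_bigr => x _.
by apply/malgP => y; rewrite mcoeffZ !mcoeffU mulrnAr mulr1.
Qed.

Lemma lin_ext_expand (K : choiceType) (W : lmodType C) (f : K -> W)
    (S : {fset K}) (v : {malg C[K]}) :
  (msupp v `<=` S)%fset -> lin_ext f v = \sum_(x <- S) v@_x *: f x.
Proof.
move=> vS; rewrite /lin_ext (big_fset_incl _ vS) // => x _ /mcoeff_outdom ->.
by rewrite scale0r.
Qed.

Lemma lin_ext_basis (K : choiceType) (W : lmodType C) (f : K -> W) x :
  lin_ext f (<< x >> : {malg C[K]}) = f x.
Proof.
by rewrite (lin_ext_expand f msuppU_le) big_seq_fset1 mcoeffU eqxx scale1r.
Qed.

Lemma lin_ext_linear (K : choiceType) (W : lmodType C) (f : K -> W) :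
  linear (lin_ext f : {malg C[K]} -> W).
Proof.
move=> a u v.
have sub := fsubset_trans (msuppD_le (a *: u) v)
              (fsetUSS (msuppZ_le a u) (fsubset_refl _)).
rewrite (lin_ext_expand f sub) (lin_ext_expand f (fsubsetUl _ (msupp v))).
rewrite (lin_ext_expand f (fsubsetUr (msupp u) _)) scaler_sumr -big_split /=.
by apply: eq_bigr => x _; rewrite mcoeffD mcoeffZ scalerDl scalerA.
Qed.

Lemma linear_ext_basis (K : choiceType) (W : lmodType C)
    (f g : {malg C[K]} -> W) : linear f -> linear g ->
  (forall x, f << x >> = g << x >>) -> f =1 g.
Proof.
move=> fL gL fg v; rewrite (malg_expand (fsubset_refl (msupp v))).
by rewrite !linear_sum_scale //; apply: eq_bigr => x _; rewrite fg.
Qed.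

End LinExt.

(** * Modes of the generating fields *)

Section Modes.
Context {C : numFieldType} {l : nat}.
Local Notation VL := (VLat C l).
Local Notation bvec := (@bvec C l).

Lemma ser_exp_at0 (W : lmodType C) (F : nat -> W -> W) v :
  ser_exp F 0 v = v.
Proof.
rewrite /ser_exp big_ord_recl big_ord0 /= /ser_one eqxx fact0 invr1.
by rewrite scale1r addr0.
Qed.

(** Every positive power of [F] applies a coefficient to [v] first; the
    vanishing at 0 carries the resulting zero through the remaining factors. *)
Lemma ser_exp_killed (W : lmodType C) (F : nat -> W -> W) v :
  (forall n, F n 0 = 0) -> (forall n, F n v = 0) ->
  forall k, ser_exp F k.+1 v = 0.
Proof.
move=> F0 Fv k.
have pow0 r j : ser_pow F r.+1 j v = 0.
  elim: r j => [|r IH] j; rewrite /ser_pow /= /ser_mul big1 // => i _.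
    by rewrite /ser_one; case: ifP; rewrite ?Fv ?F0.
  have := IH (j - i)%N; rewrite /ser_pow /= /ser_mul => ->; apply: F0.
rewrite /ser_exp big1 // => -[[|r] ri] _ /=; first by rewrite /ser_one scaler0.
by move: (pow0 r k.+1); rewrite /ser_pow /= => ->; rewrite scaler0.
Qed.

Lemma alpha_mode_linear (i : 'I_l) n : linear (alpha_mode i n : VL -> VL).
Proof. exact: lin_ext_linear. Qed.

Lemma lat_mode0 (b : Lat l) n : lat_mode b n (0 : VL) = 0.
Proof.
by apply: big1 => i _; rewrite (linear_map0 (alpha_mode_linear _ _)) scaler0.
Qed.

Lemma lat_mode_mone (b c : Lat l) n :
  lat_mode b n.+1%:Z (bvec mone c) = 0.
Proof.
apply: big1 => i _; rewrite /alpha_mode lin_ext_basis /= cm1 muln0 scale0r.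
by rewrite scaler0.
Qed.

Lemma Eplus_mone (b c : Lat l) k :
  Eplus b k.+1 (bvec mone c) = 0.
Proof.
by apply: ser_exp_killed => -[|n] //=;
  rewrite ?lat_mode0 ?lat_mode_mone scaler0 oppr0.
Qed.

Lemma Eminus0 (b : Lat l) k : Eminus b k (0 : VL) = 0.
Proof.
case: k => [|k]; first exact: ser_exp_at0.
by apply: ser_exp_killed => -[|n] //=; rewrite lat_mode0 scaler0.
Qed.

Lemma Yprod_bvec m b n v : Yprod (bvec m b) n v = Ybasis (BasisVec m b) n v.
Proof. exact: lin_ext_basis. Qed.

Lemma mon_factors_mone : mon_factors (mone : heis_mon l) = [::].
Proof.
rewrite /mon_factors mdom1.
have /size0nil -> // : size (enum_fset (fset0 : {fset 'I_l * nat})) = 0%N.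
exact: cardfs0.
Qed.

Lemma mon_factors_ucm (x : 'I_l * nat) : mon_factors (ucm x) = [:: x].
Proof.
rewrite /mon_factors mdomU.
suff -> : enum_fset [fset x]%fset = [:: x] by rewrite /= cmUU.
by apply/perm_small_eq => //; apply: uniq_perm => // y; rewrite !inE.
Qed.

(** The lowest term of [Y(e^b, z) e^c] has exponent [<b, c>] and coefficient
    [e^(b + c)]. *)
Lemma Yprod_exp_exp (b c : Lat l) :
  Yprod (bvec mone b) (- inner b c - 1) (bvec mone c) = bvec mone (b + c).
Proof.
rewrite Yprod_bvec /Ybasis mon_factors_mone /= /Yexp lin_ext_basis /=.
have n_bc : 0%:Z - 0%:Z + inner b c = - (- inner b c - 1) - 1 by lia.
rewrite (fsbigE [:: (0%N, 0%N)]) //=.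
- rewrite big_mkcond big_seq1 ifT; last by rewrite inE /= n_bc.
  by rewrite /Eminus /Eplus !ser_exp_at0.
- by move=> p /=; rewrite inE => /eqP -> /=; rewrite n_bc.
case=> p [|q] /=; last by rewrite Eplus_mone Eminus0.
rewrite opprB opprK [X in _ = X]addrC addKr subr0 => /(canRL (addrK _)).
rewrite subrr => -[->] //.
Qed.

(** [Y(1, z) = id]: all modes of the lattice element 0 vanish, so that both
    exponentials reduce to the identity. *)
Lemma Yexp0 n v : Yexp (0 : Lat l) n (v : VL) = if n == -1 then v else 0.
Proof.
have inner0 c : inner (0 : Lat l) c = 0.
  by apply: big1 => i _; rewrite ffunE mulr0 mul0r.
have lat0 k (w : VL) : lat_mode 0 k w = 0.
  by apply: big1 => i _; rewrite ffunE scale0r.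
have E0 k (w : VL) : Eminus 0 k.+1 w = 0.
  by apply: ser_exp_killed => -[|m] //=; rewrite lat0 scaler0.
have E0' k (w : VL) : Eplus 0 k.+1 w = 0.
  by apply: ser_exp_killed => -[|m] //=; rewrite lat0 scaler0 oppr0.
move: v; apply: linear_ext_basis; [exact: lin_ext_linear| |].
  by move=> a u v; case: ifP; rewrite ?scaler0 ?addr0.
move=> -[m c]; rewrite /Yexp lin_ext_basis /= inner0 add0r.
have [->|n1] := eqVneq n (-1).
  rewrite (fsbigE [:: (0%N, 0%N)]) //=.
  - by rewrite big_mkcond big_seq1 ifT ?inE // /Eminus /Eplus !ser_exp_at0.
  - by move=> p /=; rewrite inE => /eqP ->.
  by case=> -[|p] [|q] //= _ _; rewrite ?E0 // E0' Eminus0.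
apply: fsbig1 => -[[|p] [|q]] /= npq; rewrite ?E0 // ?E0' ?Eminus0 //.
by move: npq n1; lia.
Qed.

(** The normally ordered product with [Y(1, z) = id] has a single nonzero term:
    in its first sum when [n < 0], in its second when [n >= 0]. *)
Lemma Yprod_alpha (i : 'I_l) n (v : VL) :
  Yprod (bvec (ucm (i, 0%N)) 0) n v = alpha_mode i n v.
Proof.
rewrite Yprod_bvec /Ybasis mon_factors_ucm /= /nop /field_dderiv /=.
have dd (w : VL) m : (0`!%:R : C)^-1 *: alpha_mode i m w = alpha_mode i m w.
  by rewrite fact0 invr1 scale1r.
have A0 m : alpha_mode i m (0 : VL) = 0.
  exact: (linear_map0 (alpha_mode_linear _ _)).
have Yn m (w : VL) : m <> -1 -> Yexp 0 m w = 0.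
  by move=> /eqP/negbTE m1; rewrite Yexp0 m1.
have Yv m (w : VL) : m = -1 -> Yexp 0 m w = w by move=> ->; rewrite Yexp0 eqxx.
case: n => n.
  rewrite fsbig1 ?add0r => [|j _]; last by rewrite Yn ?dd ?A0 //; lia.
  rewrite (fsbigE [:: n]) //= => [|j _]; last first.
    by rewrite inE => jn; rewrite Yn //; lia.
  by rewrite big_mkcond big_seq1 ifT ?inE // Yv ?dd //; lia.
rewrite [X in _ + X]fsbig1 ?addr0 => [|j _]; last by rewrite Yn //; lia.
rewrite (fsbigE [:: n]) //= => [|j _]; last first.
  by rewrite inE => jn; rewrite Yn ?dd ?A0 //; lia.
rewrite big_mkcond big_seq1 ifT ?inE // Yv ?dd; last by lia.
by congr alpha_mode; lia.
Qed.

Lemma alpha_mode_create (i : 'I_l) k m c :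
  alpha_mode i (- k.+1%:Z) (bvec m c) = bvec (mmul (ucm (i, k)) m) c.
Proof. exact: lin_ext_basis. Qed.

Lemma Yprod_alpha_create (i : 'I_l) k m c :
  Yprod (bvec (ucm (i, 0%N)) 0) (- k.+1%:Z) (bvec m c)
    = bvec (mmul (ucm (i, k)) m) c.
Proof. by rewrite Yprod_alpha alpha_mode_create. Qed.

Lemma Yprod_linearl n (v : VL) : linear (fun u : VL => Yprod u n v).
Proof. exact: lin_ext_linear. Qed.

Lemma Yprod_alpha_createZ (s t : C) (i : 'I_l) k m c :
  Yprod (s *: bvec (ucm (i, 0%N)) 0) (- k.+1%:Z) (t *: bvec m c)
    = (s * t) *: bvec (mmul (ucm (i, k)) m) c.
Proof.
rewrite (linear_scale (Yprod_linearl _ _)) Yprod_alpha.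
by rewrite (linear_scale (alpha_mode_linear _ _)) alpha_mode_create scalerA.
Qed.

Lemma Yprod_exp_expZ (s t : C) (b c : Lat l) :
  Yprod (s *: bvec mone b) (- inner b c - 1) (t *: bvec mone c)
    = (s * t) *: bvec mone (b + c).
Proof.
have YE v : Yprod (bvec mone b) (- inner b c - 1) v
    = Yexp b (- inner b c - 1) v.
  by rewrite Yprod_bvec /Ybasis mon_factors_mone.
have EL : linear (Yexp b (- inner b c - 1) : VL -> VL).
  exact: lin_ext_linear.
rewrite (linear_scale (Yprod_linearl _ _)) YE (linear_scale EL) -YE.
by rewrite Yprod_exp_exp scalerA.
Qed.

End Modes.

(** * Generation of the rank one vertex algebra *)

Section Generation.
Context {C : numFieldType}.
Local Notation V1 := (VLat C 1).

Lemma cmonom_ind (I : choiceType) (P : {cmonom I} -> Prop) :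
  P mone -> (forall x m, P m -> P (mmul (ucm x) m)) -> forall m, P m.
Proof.
move=> P1 PM m; elim: (mdeg m) {-2}m (erefl (mdeg m)) => {m} [|d IH] m md.
  by rewrite (mdeg_eq0I md).
have [x xm] : exists x, x \in finsupp m.
  apply/fset0Pn/eqP => m0; move: md; rewrite mdegE m0 big_seq_fset0 //.
have def_m : m = mmul (ucm x) (divcm m (ucm x)).
  apply/eqP/cmP => y; rewrite cmM divcmE cmU.
  have [<-|_] := eqVneq x y; last by rewrite subn0.
  by rewrite subnKC // lt0n cmE_neq0.
rewrite def_m; apply/PM/IH; move: md; rewrite {1}def_m mdegM mdegU; lia.
Qed.

(** Basis vectors are reached from the vacuum by steps that are modes of the
    three generators: first [e^c] by translations by [+-alpha], then the
    Heisenberg part one creation operator at a time. *)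
Lemma VZalpha_basis_ind (P : VL_basis 1 -> Prop) :
    P (BasisVec mone 0) ->
    (forall c, P (BasisVec mone c) -> P (BasisVec mone (alpha ord0 + c))) ->
    (forall c, P (BasisVec mone c) -> P (BasisVec mone (- alpha ord0 + c))) ->
    (forall k m c, P (BasisVec m c) ->
       P (BasisVec (mmul (ucm (ord0, k)) m) c)) ->
  forall x, P x.
Proof.
move=> P0 Pp Pn PM [m c]; elim/cmonom_ind: m => [|[i k] m]; last first.
  by rewrite (ord1 i); apply: PM.
have def_c (z : int) : c ord0 = z -> c = alpha ord0 *~ z.
  move=> cz; apply/ffunP => i.
  by rewrite ffunMzE ffunE (ord1 i) cz mulrzz mul1r.
rewrite (def_c _ erefl); elim/int_rect: (c ord0) => [|n IH|n IH] //.
  by rewrite intS mulrzDr; apply: Pp.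
by rewrite intS opprD mulrzDr mulrN1z; apply: Pn.
Qed.

Lemma voa_automorphism_eq (g h : V1 -> V1) :
    voa_automorphism g -> voa_automorphism h ->
    g alpha_vec = h alpha_vec -> g exp_alpha = h exp_alpha ->
    g exp_Nalpha = h exp_Nalpha ->
  g =1 h.
Proof.
move=> [gL _ gY g1 _] [hL _ hY h1 _] gha ghp ghn.
apply: linear_ext_basis => //; elim/VZalpha_basis_ind => [|c IH|c IH|k m c IH].
- by rewrite -[<< _ >>]/vac g1 h1.
- by have := Yprod_exp_exp (alpha ord0) c; rewrite /bvec => <-;
    rewrite gY hY IH -[<< _ >>]/exp_alpha ghp.
- by have := Yprod_exp_exp (- alpha ord0) c; rewrite /bvec => <-;
    rewrite gY hY IH -[<< _ >>]/exp_Nalpha ghn.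
- by have := Yprod_alpha_create ord0 k m c; rewrite /bvec => <-;
    rewrite gY hY IH gha.
Qed.

Lemma voa_automorphism_id l : voa_automorphism (id : VLat C l -> VLat C l).
Proof. by split => //; exists id. Qed.

Lemma voa_automorphism_comp l (g h : VLat C l -> VLat C l) :
  voa_automorphism g -> voa_automorphism h -> voa_automorphism (g \o h).
Proof.
move=> [gL gb gY g1 gw] [hL hb hY h1 hw]; split => /=.
- by move=> a u v; rewrite /= hL gL.
- exact: bij_comp.
- by move=> u n v; rewrite /= hY gY.
- by rewrite /= h1 g1.
- by rewrite /= hw gw.
Qed.

End Generation.

(** * The automorphisms theta_1, theta_2 and sigma *)

Section Generators.
Context {C : numFieldType}.
Local Notation V1 := (VLat C 1).

Lemma theta1_basis (theta1 : V1 -> V1) : is_theta1 theta1 ->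
  forall x, theta1 << x >> = (-1) ^ lpart x ord0 *: << x >>.
Proof.
move=> [[tL _ tY t1 _] ta tp tn].
elim/VZalpha_basis_ind => [|c IH|c IH|k m c IH] /=.
- by rewrite -[<< _ >>]/vac t1 ffunE expr0z scale1r.
- have := Yprod_exp_expZ (1 : C) 1 (alpha ord0) c.
  rewrite mulr1 !scale1r /bvec => E.
  rewrite -[in LHS]E tY IH -[<< _ >>]/exp_alpha tp -scaleN1r Yprod_exp_expZ.
  by rewrite !ffunE expfzDr ?oppr_eq0 ?oner_eq0.
- have := Yprod_exp_expZ (1 : C) 1 (- alpha ord0) c.
  rewrite mulr1 !scale1r /bvec => E.
  rewrite -[in LHS]E tY IH -[<< _ >>]/exp_Nalpha tn -scaleN1r Yprod_exp_expZ.
  by rewrite !ffunE expfzDr ?oppr_eq0 ?oner_eq0 // exprN1 invrN1.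
- have := Yprod_alpha_create (C := C) ord0 k m c; rewrite /bvec => E.
  rewrite -[in LHS]E tY IH ta.
  have := Yprod_alpha_createZ (1 : C) ((-1) ^ c ord0) ord0 k m c.
  by rewrite scale1r mul1r.
Qed.

(** [theta_2] negates each creation operator and exchanges [e^alpha] with
    [e^(-alpha)]; the mode that takes [e^c] to [e^(c + alpha)] also takes
    [e^(-c)] to [e^(-c - alpha)], as [<-b, -c> = <b, c>]. *)
Lemma theta2_basis (theta2 : V1 -> V1) : is_theta2 theta2 ->
  forall x, theta2 << x >>
    = (-1) ^+ mdeg (hpart x) *: << BasisVec (hpart x) (- lpart x) >>.
Proof.
move=> [[tL _ tY t1 _] ta tp tn].
have innerN (b c : Lat 1) : inner (- b) (- c) = inner b c.
  by apply: eq_bigr => i _; rewrite !ffunE !mulrN mulNr opprK.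
elim/VZalpha_basis_ind => [|c IH|c IH|k m c IH] /=.
- by rewrite -[<< _ >>]/vac t1 mdeg1 expr0 scale1r oppr0.
- have := Yprod_exp_exp (C := C) (alpha ord0) c; rewrite /bvec => E.
  rewrite -[in LHS]E tY IH /= mdeg1 !scale1r -[<< _ >>]/exp_alpha tp.
  by rewrite -innerN Yprod_exp_exp opprD.
- have := Yprod_exp_exp (C := C) (- alpha ord0) c; rewrite /bvec => E.
  rewrite -[in LHS]E tY IH /= mdeg1 !scale1r -[<< _ >>]/exp_Nalpha tn.
  by rewrite -innerN opprK Yprod_exp_exp opprD opprK.
- have := Yprod_alpha_create (C := C) ord0 k m c; rewrite /bvec => E.
  rewrite -[in LHS]E tY IH ta /=.
  by rewrite -scaleN1r Yprod_alpha_createZ mdegM mdegU exprS.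
Qed.

Lemma sigma_exp (sigma : V1 -> V1) : is_sigma sigma ->
  sigma exp_alpha = 2^-1 *: (alpha_vec - (exp_alpha - exp_Nalpha)) /\
  sigma exp_Nalpha = 2^-1 *: (alpha_vec + (exp_alpha - exp_Nalpha)).
Proof.
move=> [[sL _ _ _ _] _ sp sn].
have two : (2 : C) != 0 by rewrite pnatr_eq0.
have sD := linear_mapD sL.
have sB u v : sigma (u - v) = sigma u - sigma v by rewrite sD linear_mapN.
rewrite -sp -[in X in X /\ _]sn; split.
  rewrite -sD addrACA subrr addr0 sD -mulr2n -scaler_nat scalerA mulVf //.
  by rewrite scale1r.
rewrite -[exp_alpha - exp_Nalpha]opprK -sn -sB opprB addrC addrA subrK.
by rewrite sD -mulr2n -scaler_nat scalerA mulVf // scale1r.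
Qed.

Lemma sigma_involution (sigma : V1 -> V1) : is_sigma sigma ->
  sigma \o sigma =1 id.
Proof.
move=> hs; have [sA sa sp sn] := hs; have [sL _ _ _ _] := sA.
have [ep en] := sigma_exp hs.
have sD := linear_mapD sL.
have sN := linear_mapN sL.
have half (u : V1) : 2^-1 *: (u + u) = u.
  by rewrite -mulr2n -scaler_nat scalerA mulVf ?pnatr_eq0 // scale1r.
apply: voa_automorphism_eq; [exact: voa_automorphism_comp
                            |exact: voa_automorphism_id| | |] => /=.
- by rewrite sa sp.
- rewrite ep (linear_scale sL) sD sN sa sn opprK addrACA subrr addr0.
  by rewrite half.
- rewrite en (linear_scale sL) sD sa sn opprB.
  by rewrite addrC addrA subrK half.
Qed.

(** [sigma] exchanges [alpha(-1)] with [e^alpha + e^(-alpha)] and negates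
    [e^alpha - e^(-alpha)]. On these three vectors [theta_1] has eigenvalues
    1, -1, -1 and [theta_2] has -1, 1, -1. *)
Lemma sigma_intertwines_theta (theta1 theta2 sigma : V1 -> V1) :
    is_theta1 theta1 -> is_theta2 theta2 -> is_sigma sigma ->
  sigma \o theta1 =1 theta2 \o sigma.
Proof.
move=> [t1A t1a t1p t1n] [t2A t2a t2p t2n] hs.
have [sA sa _ _] := hs; have [sL _ _ _ _] := sA.
have [t2L _ _ _ _] := t2A.
have [ep en] := sigma_exp hs.
apply: voa_automorphism_eq; try exact: voa_automorphism_comp; move=> /=.
- by rewrite t1a sa (linear_mapD t2L) t2p t2n addrC.
- rewrite t1p (linear_mapN sL) ep (linear_scale t2L).
  rewrite !(linear_mapD t2L, linear_mapN t2L) t2a t2p t2n.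
  rewrite -scalerN !opprD !opprK.
  by congr (_ *: (_ + _)); rewrite addrC.
- rewrite t1n (linear_mapN sL) en (linear_scale t2L).
  rewrite !(linear_mapD t2L, linear_mapN t2L) t2a t2p t2n.
  rewrite -scalerN !opprD !opprK.
  by congr (_ *: (_ + _)); rewrite addrC.
Qed.

End Generators.

(** * Tensor powers of linear maps *)

Lemma VL_basis_ext l (a b : VL_basis l) :
  hpart a =1 hpart b -> lpart a =1 lpart b -> a = b.
Proof.
case: a b => [m c] [m' c'] /= mm cc; congr BasisVec; last exact/ffunP.
exact/eqP/cmP.
Qed.

Section TensorTheory.
Context {C : numFieldType} {l : nat}.
Local Notation V1 := (VLat C 1).
Local Notation VL := (VLat C l).

Lemma hpart_slot (i : 'I_l) k (b : VL_basis l) :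
  hpart (slot i b) ((ord0 : 'I_1), k) = hpart b (i, k).
Proof.
rewrite cmE fsfun_fun /=; case: ifPn => // /negP nin; apply/esym/eqP.
rewrite cmE_eq0; apply/negP => bik; apply: nin.
by apply/imfsetP; exists (i, k).
Qed.

(** The inverse of the family [slot]. The union of the supports of the
    components bounds that of the glued monomial. *)
Definition glue (h : 'I_l -> VL_basis 1) : VL_basis l :=
  BasisVec
    [cmonom hpart (h x.1) (ord0, x.2)
      | x in (\bigcup_(i <- enum 'I_l)
                [fset (i, y.2) | y in finsupp (hpart (h i))])%fset]%M
    [ffun i => lpart (h i) ord0].

Lemma hpart_glue (h : 'I_l -> VL_basis 1) i k :
  hpart (glue h) (i, k) = hpart (h i) (ord0, k).
Proof.
rewrite cmE fsfun_fun /=; case: ifPn => // /negP nin; apply/esym/eqP.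
rewrite cmE_eq0; apply/negP => hik; apply: nin.
apply/bigfcupP; exists i; first by rewrite mem_enum.
by apply/imfsetP; exists (ord0, k).
Qed.

Lemma slot_glue (h : 'I_l -> VL_basis 1) i : slot i (glue h) = h i.
Proof.
apply: VL_basis_ext => [[j k]|j]; rewrite (ord1 j).
  by rewrite hpart_slot hpart_glue.
by rewrite /= !ffunE.
Qed.

Lemma slot_inj (a b : VL_basis l) : (forall i, slot i a = slot i b) -> a = b.
Proof.
move=> ab; apply: VL_basis_ext => [[i k]|i].
  by rewrite -!hpart_slot ab.
by have := congr1 (fun x => lpart x ord0) (ab i); rewrite /= !ffunE.
Qed.

(** A basis vector of the tensor product is determined by its components. *)
Lemma prod_delta_slot (a b : VL_basis l) :
  \prod_(i < l) ((slot i a == slot i b)%:R : C) = (a == b)%:R.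
Proof.
have [->|ab] := eqVneq a b; first by rewrite big1 // => i _; rewrite eqxx.
have [i abi] : exists i, slot i a != slot i b.
  apply: contrapT => nex; move/eqP: ab; apply; apply: slot_inj => i.
  by apply/eqP/negP => ni; apply: nex; exists i; apply/negP.
by rewrite (bigD1 i) //= (negbTE abi) mul0r.
Qed.

Section Support.
Variable (S : {fset VL_basis 1}).

Let gluef (h : {ffun 'I_l -> S}) := glue (fun i => val (h i)).

Lemma gluef_inj : injective gluef.
Proof.
move=> h k hk; apply/ffunP => i; apply: val_inj.
by rewrite -(slot_glue (fun i => val (h i))) -/(gluef h) hk slot_glue.
Qed.

(** The basis vectors all of whose components lie in [S]: a finite set that
    contains the support of [tensor v] when the [v i] are supported in [S]. *)
Definition glue_fset : {fset VL_basis l} :=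
  [fset gluef h | h in {ffun 'I_l -> S}]%fset.

Lemma big_glue_fset (W : nmodType) (F : VL_basis l -> W) :
  \sum_(b <- glue_fset) F b = \sum_(h : {ffun 'I_l -> S}) F (gluef h).
Proof.
rewrite big_imfset /=; last by move=> h k _ _; apply: gluef_inj.
by rewrite big_enum.
Qed.

Lemma prod_notin_glue_fset (v : 'I_l -> V1) b :
    (forall i, (msupp (v i) `<=` S)%fset) -> b \notin glue_fset ->
  \prod_(i < l) (v i)@_(slot i b) = 0.
Proof.
move=> vS nb; apply/eqP/negPn/negP => nz; move/negP: nb; apply.
have bS i : slot i b \in S.
  apply: (fsubsetP (vS i)); rewrite -mcoeff_neq0.
  by apply: contra nz => vi0; rewrite (bigD1 i) //= (eqP vi0) mul0r.
apply/imfsetP; exists [ffun i => [` bS i]%fset] => //.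
by apply: slot_inj => i; rewrite slot_glue ffunE.
Qed.

End Support.

Lemma tensor_expand (S : {fset VL_basis 1}) (v : 'I_l -> V1) :
    (forall i, (msupp (v i) `<=` S)%fset) ->
  tensor v =
    \sum_(b <- glue_fset S) (\prod_(i < l) (v i)@_(slot i b)) *: << b >>.
Proof.
move=> vS; apply: fsbigTE => b /prod_notin_glue_fset -> //.
by rewrite scale0r.
Qed.

Lemma common_support (v : 'I_l -> V1) :
  {S : {fset VL_basis 1} | forall i, (msupp (v i) `<=` S)%fset}.
Proof.
exists (\bigcup_(i <- enum 'I_l) msupp (v i))%fset => i.
by apply: bigfcup_sup => //; rewrite mem_enum.
Qed.

Lemma tensor_coef (v : 'I_l -> V1) b :
  (tensor v)@_b = \prod_(i < l) (v i)@_(slot i b).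
Proof.
have [S vS] := common_support v; rewrite (tensor_expand vS) raddf_sum /=.
under eq_bigr do rewrite mcoeffZ mcoeffU mulrnAr mulr1.
have [bS|bS] := boolP (b \in glue_fset S).
  rewrite (big_fsetD1 b) //= eqxx mulr1n.
  rewrite [X in _ + X]big_seq [X in _ + X]big1 ?addr0 // => a.
  by rewrite !inE => /andP[/negbTE ->].
rewrite (prod_notin_glue_fset vS bS) big_seq big1 // => a aS.
by case: eqP => // ab; rewrite ab (negbTE bS) in aS.
Qed.

Lemma tensor_scaled_basis (s : 'I_l -> C) b :
  tensor (fun i => s i *: << slot i b >>) = (\prod_(i < l) s i) *: << b >>.
Proof.
apply/malgP => a; rewrite tensor_coef mcoeffZ mcoeffU.
under eq_bigr do rewrite mcoeffZ mcoeffU.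
by rewrite big_split /= prod_delta_slot.
Qed.

Lemma tensor_power_linear (f : V1 -> V1) :
  linear (tensor_power f : VL -> VL).
Proof. exact: lin_ext_linear. Qed.

Lemma tensor_power_basis (f : V1 -> V1) (b : VL_basis l) :
  tensor_power f << b >> = tensor (fun i => f << slot i b >>).
Proof. exact: lin_ext_basis. Qed.

(** On coefficients this is the distributive law: expanding each [v i] over a
    common support [S], the sum over [S^l] of products of coefficients is the
    product over [i] of the sums over [S]. *)
Lemma tensor_power_tensor (f : V1 -> V1) (v : 'I_l -> V1) :
  linear f -> tensor_power f (tensor v) = tensor (f \o v).
Proof.
move=> fL; have [S vS] := common_support v.
rewrite (tensor_expand vS) (linear_sum_scale (tensor_power_linear f)).
apply/malgP => b; rewrite tensor_coef raddf_sum /= big_glue_fset /=.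
under eq_bigr do rewrite mcoeffZ tensor_power_basis tensor_coef
  -big_split /=.
under eq_bigr do under eq_bigr do rewrite slot_glue.
rewrite -(bigA_distr_bigA (fun i (x : S) =>
  (v i)@_(val x) * (f << val x >>)@_(slot i b))).
apply: eq_bigr => i _; rewrite {2}(malg_expand (vS i)).
rewrite (linear_sum_scale fL) raddf_sum /= [RHS]big_seq_fsetE /=.
by apply: eq_bigr => x _; rewrite mcoeffZ.
Qed.

Lemma tensor_power_comp (f g : V1 -> V1) :
  linear f ->
  tensor_power (f \o g) =1 (tensor_power f \o tensor_power g : VL -> VL).
Proof.
move=> fL; apply: linear_ext_basis; first exact: tensor_power_linear.
  by move=> a u v; rewrite /= !tensor_power_linear.
by move=> b; rewrite /= !tensor_power_basis tensor_power_tensor.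
Qed.

Lemma eq_tensor_power (f g : V1 -> V1) :
  f =1 g -> tensor_power f =1 (tensor_power g : VL -> VL).
Proof. by move=> /funext ->. Qed.

Lemma tensor_power_id : tensor_power id =1 (id : VL -> VL).
Proof.
apply: linear_ext_basis => //; first exact: tensor_power_linear.
move=> b; rewrite tensor_power_basis.
have := tensor_scaled_basis (fun=> 1) b.
by rewrite big1 // scale1r; under eq_fun do rewrite scale1r.
Qed.

Lemma tensor_power_monomial (f : V1 -> V1) (s : VL_basis 1 -> C)
    (p : VL_basis 1 -> VL_basis 1) (b b' : VL_basis l) :
    (forall x, f << x >> = s x *: << p x >>) ->
    (forall i, slot i b' = p (slot i b)) ->
  tensor_power f << b >> = (\prod_(i < l) s (slot i b)) *: << b' >>.
Proof.
move=> fE pb; rewrite tensor_power_basis -tensor_scaled_basis.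
by congr tensor; apply: funext => i; rewrite fE pb.
Qed.

End TensorTheory.

(** * Fixed vectors of the tensor powers *)

Section Signs.
Context {C : numFieldType} {l : nat}.
Local Notation VL := (VLat C l).

Lemma signz_eq1 (n : int) : ((-1 : C) ^ n = 1) <-> (2 %| n)%Z.
Proof.
have sq (q : int) : (-1 : C) ^ (q * 2) = 1.
  by rewrite mulrC -exprz_exp -exprnP sqrrN expr1n exp1rz.
split=> [n1|/dvdzP[q ->]] //.
have [n0|n0] : (n %% 2 = 0)%Z \/ (n %% 2 = 1)%Z by lia.
  by apply/dvdz_mod0P.
have /eqP := n1; rewrite (divz_eq n 2) n0 expfzDr ?oppr_eq0 ?oner_eq0 //.
by rewrite sq mul1r expr1z eqNr oner_eq0.
Qed.

Lemma prod_signz (I : finType) (c : I -> int) :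
  \prod_i (-1 : C) ^ c i = (-1) ^ (\sum_i c i).
Proof.
apply/esym/(big_morph (fun z : int => (-1 : C) ^ z)) => [x y|].
  by rewrite expfzDr ?oppr_eq0 ?oner_eq0.
exact: expr0z.
Qed.

Lemma diagonal_coef (K : choiceType) (g : {malg C[K]} -> {malg C[K]})
    (s : K -> C) :
    linear g -> (forall x, g << x >> = s x *: << x >>) ->
  forall v x, (g v)@_x = s x * v@_x.
Proof.
move=> gL gs v x.
(* A coefficient is a linear form, so that linearity reduces to the basis. *)
pose c (w : {malg C[K]}) : C^o := w@_x.
have cL : linear c by move=> a u w; rewrite /c mcoeffD mcoeffZ.
apply: (linear_ext_basis (f := c \o g) (g := fun w => s x *: c w)).
- by move=> a u w /=; rewrite gL cL.
- by move=> a u w; rewrite cL scalerDr !scalerA mulrC.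
move=> y; rewrite /= gs (linear_scale cL) /c mcoeffU.
by have [->|] := eqVneq y x; rewrite ?scaler0.
Qed.

Lemma innerNr (c b : Lat l) : inner c (- b) = - inner c b.
Proof. by rewrite -sumrN; apply: eq_bigr => i _; rewrite !ffunE mulrN. Qed.

Lemma sign_op_basis (c : Lat l) (b : VL_basis l) :
  sign_op c << b >> = (-1) ^ (inner c (lpart b) %/ 2)%Z *: << b >> :> VL.
Proof. exact: lin_ext_basis. Qed.

Lemma sign_op_linear (c : Lat l) : linear (sign_op c : VL -> VL).
Proof. exact: lin_ext_linear. Qed.

Lemma sign_op_involution (c : Lat l) :
  sign_op c \o sign_op c =1 (id : VL -> VL).
Proof.
apply: linear_ext_basis => // [a u v|b]; first by rewrite /= !sign_op_linear.
rewrite /= sign_op_basis (linear_scale (sign_op_linear c)) sign_op_basis.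
by rewrite scalerA -expfzMl mulrNN mulr1 exp1rz scale1r.
Qed.

Lemma signz_halfN (c b : Lat l) :
  (-1 : C) ^ (inner c (- b) %/ 2)%Z = (-1) ^ (inner c b %/ 2)%Z.
Proof.
have [q cb] : exists q, inner c b = q * 2.
  exists (\sum_(i < l) c i * b i); rewrite mulr_suml.
  by apply: eq_bigr => i _; rewrite [RHS]mulrC mulrA.
rewrite innerNr cb -mulNr !mulzK //.
by rewrite -exprz_inv invrN1.
Qed.

(** The signs of the slots multiply up to the sign of the coordinate sum. *)
Lemma tensor_theta1_basis (theta1 : VLat C 1 -> VLat C 1) : is_theta1 theta1 ->
  forall b : VL_basis l,
  tensor_power theta1 << b >> = (-1) ^ (\sum_(i < l) lpart b i) *: << b >>.
Proof.
move=> h1 b; rewrite (tensor_power_monomial (theta1_basis h1)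
  (p := id) (b' := b)) // -prod_signz.
by congr (_ *: _); apply: eq_bigr => i _; rewrite ffunE.
Qed.

Lemma tensor_theta2_basis (theta2 : VLat C 1 -> VLat C 1) : is_theta2 theta2 ->
  forall b : VL_basis l, exists s : C,
  tensor_power theta2 << b >> = s *: << BasisVec (hpart b) (- lpart b) >>.
Proof.
move=> h2 b; eexists.
apply: (tensor_power_monomial (theta2_basis h2)) => i.
by apply: VL_basis_ext => //= j; rewrite !ffunE.
Qed.

Lemma sign_op_tensor_theta2 (theta2 : VLat C 1 -> VLat C 1) (c : Lat l) :
    is_theta2 theta2 ->
  sign_op c \o tensor_power theta2
    =1 (tensor_power theta2 \o sign_op c : VL -> VL).
Proof.
move=> h2; have tL := tensor_power_linear (l := l) theta2.
have sL := sign_op_linear c.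
apply: linear_ext_basis => [a u v|a u v|b]; rewrite /= ?tL ?sL ?tL //.
have [s psi2b] := tensor_theta2_basis h2 b.
rewrite sign_op_basis psi2b (linear_scale tL) (linear_scale sL) psi2b.
by rewrite sign_op_basis signz_halfN !scalerA mulrC.
Qed.

End Signs.

Lemma image_fixed_points (T : Type) (p1 p2 t f : T -> T) :
    involutive t -> involutive f ->
    (forall v, t (p1 v) = p2 (t v)) -> (forall v, f (p2 v) = p2 (f v)) ->
  (f \o t) @` [set v | p1 v = v] = [set v | p2 v = v].
Proof.
move=> tK fK tp fp; apply/seteqP; split => [_ [v /= p1v <-]|w /= p2w].
  by rewrite -fp -tp p1v.
exists (t (f w)) => /=; last by rewrite tK fK.
by rewrite -[LHS]tK tp tK -fp p2w.
Qed.

Theorem lemma3p6 (R : realType) (l : nat) (hl : (3 <= l)%N)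
    (theta1 theta2 sigma : VLat R[i] 1 -> VLat R[i] 1)
    (htheta1 : is_theta1 theta1) (htheta2 : is_theta2 theta2)
    (hsigma : is_sigma sigma) :
  let psi1 : VLat R[i] l -> VLat R[i] l := tensor_power theta1 in
  let psi2 : VLat R[i] l -> VLat R[i] l := tensor_power theta2 in
  let tau : VLat R[i] l -> VLat R[i] l := tensor_power sigma in
  let rho : VLat R[i] l -> VLat R[i] l := phi hl \o tau in
  [/\ latN l = [set b | (inner (\sum_(i < l) alpha i) b = 0 %[mod 4])%Z],
      VN R[i] l = [set v | psi1 v = v]
    & rho @` VN R[i] l = [set v | psi2 v = v]].
Proof.
move=> psi1 psi2 tau rho.
have VN_fixed : VN R[i] l = [set v | psi1 v = v].
  have psi1_coef := diagonal_coef (tensor_power_linear theta1)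
    (tensor_theta1_basis (l := l) htheta1).
  apply/seteqP; split => v /= hv.
    apply/malgP => b; rewrite psi1_coef.
    by case: msuppP => [/hv/latN_even/signz_eq1 ->|]; rewrite ?mulr0 ?mul1r.
  move=> b bv; apply/latN_even/(@signz_eq1 R[i])/eqP.
  have := psi1_coef v b; rewrite -/psi1 hv => /eqP.
  rewrite -[X in X == _]mul1r (inj_eq (mulIf _)) ?mcoeff_neq0 //.
  by rewrite eq_sym.
split; [|exact: VN_fixed|].
  apply/seteqP; split => b /=; rewrite inner_alpha_sum.
    by move/latN_even; lia.
  by move=> hb; apply/latN_even; lia.
have [[sigmaL _ _ _ _] _ _ _] := hsigma.
have [[theta2L _ _ _ _] _ _ _] := htheta2.
rewrite VN_fixed; apply: image_fixed_points => v.
- have := tensor_power_comp sigma sigmaL v.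
  by rewrite (eq_tensor_power (sigma_involution hsigma)) tensor_power_id.
- exact: sign_op_involution.
- rewrite -[LHS](tensor_power_comp theta1 sigmaL).
  rewrite (eq_tensor_power (sigma_intertwines_theta htheta1 htheta2 hsigma)).
  exact: (tensor_power_comp sigma theta2L).
- exact: (sign_op_tensor_theta2 _ htheta2).
Qed.
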